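(* In the setting described in the context, let $1\le r\le m$. (1) Assume that $S_n$ is positive on $D_n$ for all $n\in\Lambda_r$. Then the matrices $\underline{M}_{r,k}|_{\Theta_{r,k}}$ and $\overline{M}_{r,k}|_{\Theta_{r,k}}$ are irreducible for all positive integers $k$. (2) Assume that $S_n$ is positive on $D_n\cap K_r$ for all $n\in\Lambda_r$. Then there exists a positive integer $k_0$ such that $\underline{M}_{r,k}|_{\Theta_{r,k}}$ and $\overline{M}_{r,k}|_{\Theta_{r,k}}$ are irreducible for all $k\ge k_0$.
   Context: Setting. Let $N\ge 2$ and let $(x_0,y_0),\dots,(x_N,y_N)\in\mathbb{R}^2$ with $x_0<x_1<\cdots<x_N$ and $x_n-x_{n-1}=(x_N-x_0)/N$ for $1\le n\le N$. For each $1\le n\le N$ fix integers $0\le u(n)<v(n)\le N$ and put $I_n=[x_{n-1},x_n]$, $D_n=[x_{u(n)},x_{v(n)}]$. Let $L_n(x)=a_nx+b_n$ be an affine contractive homeomorphism of $D_n$ onto $I_n$ ($a_n$ may be negative), and let $S_n,q_n:D_n\to\mathbb{R}$ be continuous functions of bounded variation with $|S_n(x)|<1$ for all $x\in D_n$. With $W_n(x,y)=(L_n(x),S_n(x)y+q_n(x))$ on $D_n\times\mathbb{R}$, assume $W_n(\{(x_{u(n)},y_{u(n)}),(x_{v(n)},y_{v(n)})\})=\{(x_{n-1},y_{n-1}),(x_n,y_n)\}$. Components. For $i,j\in\{1,\dots,N\}$ there is an edge from $j$ to $i$ if $I_j\subset D_i$. For $\emptyset\neq V\subset\{1,\dots,N\}$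 and $i,j\in V$, a path in $V$ from $j$ to $i$ is a finite sequence $i_0,\dots,i_t$ ($t\ge1$) in $V$ with $i_0=j$, $i_t=i$ and an edge from $i_{\ell-1}$ to $i_\ell$ for each $1\le\ell\le t$. $V$ is strongly connected if for all $i,j\in V$ there is a path in $V$ from $j$ to $i$; a strongly connected component is a strongly connected set that is maximal under inclusion. Let $\Lambda_1,\dots,\Lambda_m$ be all the strongly connected components of $\{1,\dots,N\}$. Standing assumption: for each $r$ there is an integer $T_r\ge2$ with $|D_n|/|I_n|=T_r$ for all $n\in\Lambda_r$ ($|J|$ is the length of $J$). Basic sets. $B_{r,0}=\bigcup_{n\in\Lambda_r}D_n$, $B_{r,k}=\bigcup_{n\in\Lambda_r}L_n(B_{r,k-1}\cap D_n)$ for $k\ge1$ (a decreasing sequence of compact sets), and $K_r=\bigcap_{k\ge0}B_{r,k}$. Also $\mathcal{B}_{r,0}=\{D_n:n\in\Lambda_r\}$, $\mathcal{B}_{r,k}=\{L_n(E):n\in\Lambda_r,\ E\in\mathcal{B}_{r,k-1},\ E\subset D_n\}$ for $k\ge1$. Intervals. Write $\Lambda_r=\{a_{r,1}<\cdots<a_{r,d_r}\}$. For $k\ge1$, $1\le t\le d_r$, $1\le j\le T_r^{k-1}$, let $I^k_{r,(t-1)T_r^{k-1}+j}=\big[x_{a_{r,t}-1}+\tfrac{(j-1)(x_N-x_0)}{NT_r^{k-1}},\,x_{a_{r,t}-1}+\tfrac{j(x_N-x_0)}{NT_r^{k-1}}\big]$. Each element of $\mathcal{B}_{r,k}$, $k\ge1$,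 equals $I^k_{r,i}$ for a unique $i$; put $\Theta_{r,k}=\{1\le i\le d_rT_r^{k-1}: I^k_{r,i}\in\mathcal{B}_{r,k}\}$. For $1\le i\le d_rT_r^{k-1}$ let $n$ be the unique index with $I^k_{r,i}\subset I_n$ and put $D^k_{r,i}=L_n^{-1}(I^k_{r,i})$. Matrices. $\overline{M}_{r,k}$ and $\underline{M}_{r,k}$ are the $d_rT_r^{k-1}\times d_rT_r^{k-1}$ matrices with $(i,j)$ entries $\overline{s}^k_{r,i,j}=\max\{|S_n(x)|:x\in I^k_{r,j}\}$ and $\underline{s}^k_{r,i,j}=\min\{|S_n(x)|:x\in I^k_{r,j}\}$ respectively if $I^k_{r,j}\subset D^k_{r,i}$ (where $n$ is the unique index with $I^k_{r,i}\subset I_n$), and $0$ otherwise. For a square matrix $A$ and a set of indices $\Theta$, $A|_\Theta=(a_{ij})_{i,j\in\Theta}$. A nonnegative square matrix $A=(a_{ij})$ is irreducible if for all indices $i,j$ there is a finite sequence $i_0=i,i_1,\dots,i_t=j$ ($t\ge1$) of indices with $a_{i_{\ell-1},i_\ell}>0$ for all $1\le\ell\le t$. *)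

(* Defs.v *)
From HB Require Import structures.
From mathcomp Require Import all_boot all_order all_algebra.
From mathcomp Require Import all_classical all_reals all_analysis.
From mathcomp Require Import ring lra.

Set Implicit Arguments.
Unset Strict Implicit.
Unset Printing Implicit Defensive.

Import Order.TTheory GRing.Theory Num.Theory.
Import numFieldNormedType.Exports.

Local Open Scope classical_set_scope.
Local Open Scope ring_scope.

(* W_n(x, y) = (L_n(x), S_n(x) y + q_n(x)) with L_n(x) = slope n * x + icpt n,
   S_n = scal n, q_n = offs n, on D_n = [x_{u(n)}, x_{v(n)}] with u = lo, v = hi.
   The N maps are indexed by n : 'I_N, counted from 0: the index n stands for
   the textbook index n + 1, so that I_n is [x n, x n.+1].  The knots keep their
   numbering 0, ..., N; the values of [kx] and [ky] beyond N are never used, and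
   neither are the values of [scal n] and [offs n] outside D_n. *)
Record rif_data (R : realType) (N : nat) := RifData {
  kx : nat -> R;
  ky : nat -> R;
  lo : 'I_N -> nat;
  hi : 'I_N -> nat;
  slope : 'I_N -> R;
  icpt : 'I_N -> R;
  scal : 'I_N -> R -> R;
  offs : 'I_N -> R -> R }.

Section System.
Variables (R : realType) (N : nat) (F : rif_data R N).

Definition Iset (n : 'I_N) : set R := [set` `[kx F n, kx F n.+1]].

Definition Dset (n : 'I_N) : set R := [set` `[kx F (lo F n), kx F (hi F n)]].

Definition Lmap (n : 'I_N) (t : R) : R := slope F n * t + icpt F n.

Definition Wmap (n : 'I_N) (p : R * R) : R * R :=
  (Lmap n p.1, scal F n p.1 * p.2 + offs F n p.1).

Record rif_system : Prop := RifSystem {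
  rif_N : (2 <= N)%N;
  rif_incr : forall i : nat, (i < N)%N -> kx F i < kx F i.+1;
  rif_unif : forall i : nat, (i < N)%N ->
    kx F i.+1 - kx F i = (kx F N - kx F 0%N) / N%:R;
  rif_lohi : forall n, (lo F n < hi F n)%N;
  rif_hiN : forall n, (hi F n <= N)%N;
  rif_contr : forall n, `|slope F n| < 1;
  rif_homeo : forall n, set_bij (Dset n) (Iset n) (Lmap n);
  rif_scal_cont : forall n, {within Dset n, continuous (scal F n)};
  rif_scal_bv : forall n,
    bounded_variation (kx F (lo F n)) (kx F (hi F n)) (scal F n);
  rif_scal_lt1 : forall n t, Dset n t -> `|scal F n t| < 1;
  rif_offs_cont : forall n, {within Dset n, continuous (offs F n)};
  rif_offs_bv : forall n,
    bounded_variation (kx F (lo F n)) (kx F (hi F n)) (offs F n);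
  rif_ends : forall n,
    Wmap n @` [set (kx F (lo F n), ky F (lo F n));
                   (kx F (hi F n), ky F (hi F n))]
    = [set (kx F n, ky F n); (kx F n.+1, ky F n.+1)] }.

Definition edge : rel 'I_N := fun j i => `[< Iset j `<=` Dset i >].

Definition path_in (V : {set 'I_N}) (j i : 'I_N) : Prop :=
  exists p : seq 'I_N,
    [/\ p != [::], {subset j :: p <= V}, path edge j p & last j p = i].

Definition strongly_connected (V : {set 'I_N}) : Prop :=
  V != finset.set0 /\ {in V &, forall i j, path_in V j i}.

Definition scc (V : {set 'I_N}) : Prop :=
  strongly_connected V /\
  forall V' : {set 'I_N}, strongly_connected V' -> V \subset V' -> V' = V.

Definition ratio_on (V : {set 'I_N}) (T : nat) : Prop :=
  {in V, forall n,
    (kx F (hi F n) - kx F (lo F n)) / (kx F n.+1 - kx F n) = T%:R}.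

Variable V : {set 'I_N}.

Fixpoint Bset (k : nat) : set R :=
  if k is k'.+1
  then \bigcup_(n in [set` V]) (Lmap n @` (Bset k' `&` Dset n))
  else \bigcup_(n in [set` V]) Dset n.

Definition Kset : set R := \bigcap_(k in [set: nat]) Bset k.

Fixpoint Bfam (k : nat) : set (set R) :=
  if k is k'.+1
  then [set J | exists n E,
         [/\ n \in V, Bfam k' E, E `<=` Dset n & J = Lmap n @` E]]
  else [set J | exists2 n, n \in V & J = Dset n].

Variables (T k : nat).

(* The intervals I^k_i (k >= 1) are indexed from 0: the textbook index
   (t - 1) T^(k-1) + j becomes i = (t - 1) T^(k-1) + (j - 1), so that t - 1 and
   j - 1 are the quotient and the remainder of i by T^(k-1). *)
Definition nsub : nat := (T ^ k.-1)%N.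

Definition nidx : nat := (#|V| * nsub)%N.

Lemma block_subproof (i : 'I_nidx) : (i %/ nsub < #|V|)%N.
Proof.
case: i => i /=; rewrite /nidx; have [->|q_gt0] := posnP nsub.
  by rewrite muln0.
by rewrite ltn_divLR.
Qed.

(* [enum_val] enumerates V in increasing order, so [owner i] is a_{r,t}
   (see [enum_val_lt]); it is the unique index n such that I^k_i is contained in I_n, see [ownerP]. *)
Definition owner (i : 'I_nidx) : 'I_N :=
  enum_val (Ordinal (block_subproof i)).

Definition cell (i : 'I_nidx) : set R :=
  let h := (kx F N - kx F 0%N) / (N%:R * nsub%:R) in
  [set` `[kx F (owner i) + (i %% nsub)%:R * h,
          kx F (owner i) + (i %% nsub).+1%:R * h]].

Definition Theta : {set 'I_nidx} := finset (fun i => `[< Bfam k (cell i) >]).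

Definition Dcell (i : 'I_nidx) : set R :=
  Dset (owner i) `&` Lmap (owner i) @^-1` cell i.

(* [sup] and [inf] are a maximum and a minimum here: under the guard, the j-th
   cell is a compact interval contained in the domain D_n of the continuous
   function [scal F n], n being the owner of i. *)
Definition Mover : 'M[R]_nidx := \matrix_(i, j)
  if `[< cell j `<=` Dcell i >]
  then sup [set `|scal F (owner i) t| | t in cell j] else 0.

Definition Munder : 'M[R]_nidx := \matrix_(i, j)
  if `[< cell j `<=` Dcell i >]
  then inf [set `|scal F (owner i) t| | t in cell j] else 0.

End System.

Definition submx_on (R : Type) (n : nat) (A : 'M[R]_n) (X : {set 'I_n}) :
  'M[R]_#|X| := mxsub enum_val enum_val A.

(* Irreducibility is a notion for nonnegative matrices, hence the first
   conjunct. *)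
Definition irreducible_mx (R : numDomainType) (n : nat) (A : 'M[R]_n) : Prop :=
  (forall i j, 0 <= A i j) /\
  forall i j, exists p : seq 'I_n,
    [/\ p != [::], path (fun a b => 0 < A a b) i p & last i p = j].

Lemma enum_val_lt (N : nat) (V : {set 'I_N}) (s t : 'I_#|V|) :
  (s < t)%N -> (enum_val s < enum_val t)%N.
Proof.
move=> st; have st_enum : sorted ltn (map val (enum V)).
  have -> : enum V = [seq n <- enum 'I_N | n \in V] by rewrite enumT.
  rewrite sorted_map; apply: sorted_filter.
    by move=> a b c /=; apply: ltn_trans.
  by have := iota_ltn_sorted 0 N; rewrite -val_enum_ord sorted_map.
have x0 : 'I_N := enum_val s.
rewrite !(enum_val_nth x0) -!(nth_map x0 0%N val) -?cardE //.
by apply: (sorted_ltn_nth ltn_trans) => //; rewrite inE size_map -cardE.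
Qed.

Lemma kx_le (R : realType) (N : nat) (F : rif_data R N) (i j : nat) :
  rif_system F -> (i <= j <= N)%N -> kx F i <= kx F j.
Proof.
move=> FS /andP[ij]; rewrite -(subnKC ij); elim: (j - i)%N => [|d IH] ltN.
  by rewrite addn0.
rewrite addnS in ltN *.
by apply: le_trans (IH (ltnW ltN)) _; apply/ltW/rif_incr.
Qed.

Lemma ownerP (R : realType) (N : nat) (F : rif_data R N) (V : {set 'I_N})
    (T k : nat) (i : 'I_(nidx V T k)) (n : 'I_N) :
  rif_system F -> (cell F i `<=` Iset F n <-> n = owner i).
Proof.
move=> FS; set o := owner i; set q := nsub T k.
have q_gt0 : (0 < q)%N.
  by case: (posnP q) (ltn_ord i) => // q0; rewrite {2}/nidx -/q q0 muln0.
have N_gt0 : (0 < N)%N by apply: leq_trans (rif_N FS).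
have ho := rif_unif FS (ltn_ord o); have lto := rif_incr FS (ltn_ord o).
set h := (kx F N - kx F 0%N) / (N%:R * q%:R).
have hq : h * q%:R = kx F o.+1 - kx F o.
  rewrite ho /h; field.
  by rewrite !pnatr_eq0 -!lt0n q_gt0 N_gt0.
have qR : 0 < q%:R :> R by rewrite ltr0n.
have h_gt0 : 0 < h by rewrite -(pmulr_lgt0 _ qR) hq subr_gt0.
set c := (i %% q)%N.
have cq : (c < q)%N by rewrite ltn_pmod.
have c0 : 0 <= c%:R * h by rewrite mulr_ge0 // ltW.
have c1 : c.+1%:R * h <= q%:R * h by rewrite ler_pM2r // ler_nat.
have cS : c.+1%:R * h = c%:R * h + h by rewrite -natr1 mulrDl mul1r.
rewrite /cell -/o -/q -/c -/h /Iset; split=> [sub|-> t /=]; last first.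
  rewrite !in_itv /= => /andP[t1 t2]; apply/andP; split; lra.
pose mid := kx F o + c%:R * h + h / 2.
have := sub mid; rewrite /= !in_itv /= => /(_ _)/andP[].
  by apply/andP; split; rewrite /mid; lra.
move=> m1 m2; apply/val_inj/eqP; rewrite eqn_leq.
case: (ltnP o n) => [on|no].
  have le := kx_le FS (introT andP (conj on (ltnW (ltn_ord n)))).
  by exfalso; rewrite /mid in m1; lra.
case: (ltnP n o) => [no'|//].
have le := kx_le FS (introT andP (conj no' (ltnW (ltn_ord o)))).
by exfalso; rewrite /mid in m2; lra.
Qed.

(* Main.v *)
Require Import Defs.
From HB Require Import structures.
From mathcomp Require Import all_boot all_order all_algebra.
From mathcomp Require Import all_classical all_reals all_analysis.
From mathcomp Require Import ring lra zify.

Set Implicit Arguments.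
Unset Strict Implicit.
Unset Printing Implicit Defensive.

Import Order.TTheory GRing.Theory Num.Theory.
Import numFieldNormedType.Exports.

Local Open Scope classical_set_scope.
Local Open Scope ring_scope.

(* Code the intervals of the k-th level by words n1 ... nk over V with an edge
   from n_{l+1} to n_l, the word standing for
   L_{n1} o ... o L_{n_{k-1}} (I_{nk}).  In these terms the incidence relation
   "cell j is contained in Dcell i" contains the shift n1 w -> w m, so strong
   connectivity of V lets one slide from any word to any other: join the last
   letter of the first to the first letter of the second by a path and read
   off consecutive windows of length k.  It remains to see that the entries are
   positive; in part (2) this holds for large k, since the compact sets
   {t in D_n : S_n t <= 0} are disjoint from K, hence from B_k for k large. *)

(** * Nested compact sets, and affine images of intervals *)

(** Finite intersection property: if no [A] ∩ [B k] were empty, nestedness would make every finite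
    intersection nonempty, hence the whole one too. *)
Lemma nested_compact_disjoint (X : ptopologicalType) (A : set X)
    (B : nat -> set X) :
  compact A -> (forall k, closed (B k)) -> (forall k, B k.+1 `<=` B k) ->
  A `&` \bigcap_(k in [set: nat]) B k = set0 ->
  exists k0, forall k, (k0 <= k)%N -> A `&` B k = set0.
Proof.
move=> cA cB decB AB0.
have dec j k : (j <= k)%N -> B k `<=` B j.
  move=> /subnKC <-; elim: (k - j)%N => [|d IH]; rewrite ?addn0 // addnS.
  exact: subset_trans (decB _) IH.
suff [k Ak] : exists k, A `&` B k = set0.
  exists k => j kj; apply/seteqP; split => // x [Ax /(dec _ _ kj) Bx].
  by rewrite -Ak.
apply: contrapT => /forallNP ABn0.
move: cA; rewrite compact_In0 => /(_ nat setT (fun k => A `&` B k)) [].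
- by exists B.
(* The largest index of a finite subfamily gives its smallest member. *)
- move=> D' _; pose M := (\max_(i <- finmap.enum_fset D') i)%N.
  have /eqP/set0P[x [Ax BMx]] := ABn0 M.
  exists x => i /= iD; split=> //; apply: (dec _ M) => //.
  exact: (@leq_bigmax_seq _ _ xpredT id).
- move=> x xAB; have [Ax _] := xAB 0%N I.
  suff: (set0 : set X) x by [].
  by rewrite -AB0; split => // k _; have [] := xAB k I.
Qed.

Lemma affine_image_itv (R : realType) (a b c d : R) :
  a != 0 -> (fun t => a * t + b) @` [set` `[c, d]] =
  if 0 < a then [set` `[a * c + b, a * d + b]]
  else [set` `[a * d + b, a * c + b]].
Proof.
move=> a0; case: ifP => [a_gt0|/negbT].
  apply/seteqP; split=> [_ [t + <-]|y] /=; rewrite !in_itv /=.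
    by rewrite !lerD2r !ler_pM2l.
  move=> yI; exists ((y - b) / a); last by field.
  by rewrite /= in_itv /= ler_pdivlMr // ler_pdivrMr // lerBrDr lerBlDr
             ![_ * a]mulrC.
rewrite -leNgt le_eqVlt (negbTE a0) /= => a_lt0.
apply/seteqP; split=> [_ [t + <-]|y] /=; rewrite !in_itv /=.
  by rewrite !lerD2r !ler_nM2l // andbC.
move=> yI; exists ((y - b) / a); last by field.
by rewrite /= in_itv /= ler_ndivlMr // ler_ndivrMr // lerBrDr lerBlDr
           ![_ * a]mulrC andbC.
Qed.

Lemma itv_cc_inj (R : realType) (a b c d : R) : a <= b -> c <= d ->
  [set` `[a, b]] = [set` `[c, d]] -> a = c /\ b = d.
Proof.
move=> ab cd E; have mem t : (a <= t <= b) = (c <= t <= d).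
  have : [set` `[a, b]] t = [set` `[c, d]] t by rewrite E.
  by rewrite /= !in_itv /= => e; apply/idP/idP; rewrite ?e // -e.
have := mem a; have := mem b; have := mem c; have := mem d.
rewrite !lexx ab cd !andbT /= => /andP[ad db] /andP[ac cb] /esym/andP[? ?].
by move=> /esym/andP[? ?]; split; apply/le_anti/andP; split.
Qed.

(** * The uniform grid of knots, the maps L_n and the edges *)

Section Words.
Variables (R : realType) (N : nat) (F : rif_data R N).
Hypothesis FS : rif_system F.
Implicit Types (n o : 'I_N) (w : seq 'I_N).

Definition mesh : R := (kx F N - kx F 0%N) / N%:R.
Local Notation H := mesh.


Lemma kx_step i : (i < N)%N -> kx F i.+1 - kx F i = mesh.
Proof. exact: rif_unif. Qed.

Lemma kxE i : (i <= N)%N -> kx F i = kx F 0%N + i%:R * H.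
Proof.
elim: i => [|i IH] iN; first by rewrite mul0r addr0.
rewrite -natr1 mulrDl mul1r addrA -(IH (ltnW iN)) -(kx_step iN).
by rewrite addrC subrK.
Qed.

Lemma mesh_gt0 : 0 < H.
Proof.
have N0 : (0 < N)%N by rewrite (leq_trans _ (rif_N FS)).
by rewrite -(kx_step N0) subr_gt0 rif_incr.
Qed.

Lemma kx_le_nat i j : (i <= N)%N -> (j <= N)%N ->
  (kx F i <= kx F j) = (i <= j)%N.
Proof.
move=> iN jN.
by rewrite (kxE iN) (kxE jN) lerD2l ler_pM2r ?mesh_gt0 // ler_nat.
Qed.

Lemma kx_lt_nat i j : (i <= N)%N -> (j <= N)%N ->
  (kx F i < kx F j) = (i < j)%N.
Proof. by move=> iN jN; rewrite ltNge (kx_le_nat jN iN) ltnNge. Qed.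

Lemma lo_leN n : (lo F n <= N)%N.
Proof. exact: leq_trans (ltnW (rif_lohi FS n)) (rif_hiN FS n). Qed.

Let loN := lo_leN.
Let hiN := rif_hiN FS.

Lemma slope_neq0 n : slope F n != 0.
Proof.
apply/eqP => s0; have lh : kx F (lo F n) < kx F (hi F n).
  by rewrite kx_lt_nat ?rif_lohi.
have [_ inj _] := rif_homeo FS n.
have /eqP : kx F (lo F n) = kx F (hi F n).
  apply: inj; rewrite ?inE /Dset /= ?in_itv /= ?lexx ?(ltW lh) //.
  by rewrite /Lmap s0 !mul0r.
by rewrite (lt_eqF lh).
Qed.

Lemma Lmap_inj n : injective (Lmap F n).
Proof. by move=> s t /addIr /(mulfI (slope_neq0 n)). Qed.

Lemma Lmap_Dset n : Lmap F n @` Dset F n = Iset F n.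
Proof.
have [/image_subP f _ s] := rif_homeo FS n.
by apply/seteqP; split=> [_ [t Dt <-]|]; [exact: f|exact: s].
Qed.

Lemma edgeP o n : edge F o n <-> (lo F n <= o)%N /\ (o < hi F n)%N.
Proof.
have oN := ltn_ord o; have oN' := ltnW oN.
split=> [/asboolP sub|[lo_o o_hi]].
  have le1 : kx F o <= kx F o.+1 by rewrite kx_le_nat.
  have /sub : Iset F o (kx F o) by rewrite /Iset /= in_itv /= lexx.
  have /sub : Iset F o (kx F o.+1) by rewrite /Iset /= in_itv /= lexx andbT.
  rewrite /Dset /= !in_itv /= !kx_le_nat //.
  by move=> /andP[_ ->] /andP[-> _].
apply/asboolP => t; rewrite /Iset /Dset /= !in_itv /= => /andP[t1 t2].
by rewrite (le_trans _ t1) ?(le_trans t2) // kx_le_nat.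
Qed.

(** The end points of D_n are knots, so D_n cannot cut I_o in its interior: an overlap of positive
    length contains all of I_o. *)
Lemma edge_overlap o n (s t : R) : s < t -> Iset F o s -> Iset F o t ->
  Dset F n s -> Dset F n t -> edge F o n.
Proof.
rewrite /Iset /Dset /= !in_itv /= => st.
move=> /andP[s1 s2] /andP[t1 t2] /andP[s3 s4] /andP[t3 t4].
have oN := ltn_ord o; have oN' := ltnW oN.
apply/edgeP; split.
  by rewrite -ltnS -kx_lt_nat //; lra.
by rewrite -kx_lt_nat //; lra.
Qed.

(* [wset (n1 :: ... :: nk)] is the image of D_{nk} under
   L_{n1} o ... o L_{nk} when the word is admissible. *)
Fixpoint wset w : set R :=
  if w is n :: w' then Lmap F n @` (Dset F n `&` wset w') else setT.

Lemma wset_sub_Iset n w : wset (n :: w) `<=` Iset F n.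
Proof. by rewrite -Lmap_Dset /=; apply: image_subset; apply: subIsetl. Qed.

Lemma wset_rcons w n : wset (rcons w n) `<=` wset w.
Proof.
elim: w => [|o w IH] //=; apply: image_subset.
exact: setIS.
Qed.

(** * Admissible words and their images *)

Variable V : {set 'I_N}.

Definition admissible w := all (mem V) w && sorted (fun n o => edge F o n) w.

Lemma admissible_cons n o w :
  admissible [:: n, o & w] = [&& n \in V, edge F o n & admissible (o :: w)].
Proof. by rewrite /admissible /= -!andbA; do !bool_congr. Qed.

Lemma admissible_behead n w : admissible (n :: w) -> admissible w.
Proof. by case: w => // o w; rewrite admissible_cons => /and3P[]. Qed.

Lemma wset_sub_Dset n w :
  admissible (n :: w) -> w != [::] -> wset w `<=` Dset F n.
Proof.
case: w => // o w; rewrite admissible_cons => /and3P[_ /asboolP sub _] _.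
exact: subset_trans (@wset_sub_Iset _ _) sub.
Qed.

Lemma wset1 n : wset [:: n] = Iset F n.
Proof. by rewrite /= setIT Lmap_Dset. Qed.

(** The edge from [o] to [n] already puts the tail inside D_n, so the intersection in [wset] cuts
    nothing off. *)
Lemma wset_cons n o w : admissible [:: n, o & w] ->
  wset [:: n, o & w] = Lmap F n @` wset (o :: w).
Proof.
move=> adm; have sub := wset_sub_Dset adm isT.
rewrite [LHS]/= -/(wset (o :: w)); congr (_ @` _).
by apply/seteqP; split=> [t []//|t wt]; split=> //; apply: sub.
Qed.

(** Two distinct points survive each injective L_n; [edge_overlap] needs them to recover an edge
    from an inclusion. *)
Lemma wset_nontrivial n w : admissible (n :: w) ->
  exists s t, [/\ s < t, wset (n :: w) s & wset (n :: w) t].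
Proof.
elim: w n => [|o w IH] n adm.
  have lt : kx F n < kx F n.+1 by apply: rif_incr.
  exists (kx F n), (kx F n.+1).
  by rewrite wset1 /Iset /= !in_itv /= lexx lexx (ltW lt).
have [s [t [st ws wt]]] := IH o (admissible_behead adm).
rewrite (wset_cons adm).
have : Lmap F n s != Lmap F n t by rewrite (inj_eq (@Lmap_inj n)) lt_eqF.
by rewrite neq_lt => /orP[lt|lt]; [exists (Lmap F n s), (Lmap F n t)|
  exists (Lmap F n t), (Lmap F n s)]; split=> //; apply: imageP.
Qed.

(** * Basic intervals as word images, and their place among the cells *)

Variable T : nat.
Hypothesis T_ge2 : (2 <= T)%N.
Hypothesis TP : ratio_on F V T.

Lemma hi_lo n : n \in V -> hi F n = (lo F n + T)%N.
Proof.
move=> nV; have := TP nV; have lh := rif_lohi FS n; have nN := ltn_ord n.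
rewrite (kx_step nN) (kxE (loN n)) (kxE (hiN n)) => e.
have H0 : H != 0 := lt0r_neq0 mesh_gt0.
have {}e : (hi F n)%:R - (lo F n)%:R = T%:R :> R by rewrite -e; field.
apply/eqP; rewrite -(eqr_nat R) natrD -e addrC subrK //.
Qed.

(** Induction on the level: level one consists of the I_n, the one-letter words, and by
    [edge_overlap] an inclusion in D_n is exactly an edge that allows [n] to be prepended. *)
Lemma BfamP k J : Bfam F V k.+1 J <->
  exists2 w, admissible w /\ size w = k.+1 & J = wset w.
Proof.
elim: k J => [|k IH] J.
  split=> [[n [_ [nV [m mV ->] mn ->]]]|[w [adm sz] ->]].
    exists [:: n]; first by rewrite /admissible /= nV.
    (* D_m and D_n both span [T] grid steps, so the inclusion [mn] forces them to be equal. *)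
    rewrite wset1 -Lmap_Dset; congr (_ @` _); apply/seteqP; split=> //.
    have lh := rif_lohi FS m.
    have le1 : kx F (lo F m) <= kx F (hi F m) by rewrite kx_le_nat // ltnW.
    have /mn : Dset F m (kx F (lo F m)) by rewrite /Dset /= in_itv /= lexx.
    have /mn : Dset F m (kx F (hi F m)).
      by rewrite /Dset /= in_itv /= lexx andbT.
    rewrite /Dset /= !in_itv /= !kx_le_nat // !hi_lo // leq_add2r.
    move=> /andP[_ le2] /andP[le3 _].
    by have -> : lo F m = lo F n by apply/eqP; rewrite eqn_leq le2.
  case: w adm sz => // n [] // /andP[/andP[nV _] _] _.
  exists n, (Dset F n); split=> //; first by exists n.
  by rewrite wset1 Lmap_Dset.
split=> [[n [E [nV /IH[w [adm sz] ->] sub ->]]]|[w [adm sz] ->]].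
  case: w adm sz sub => // o w adm [sz] sub.
  have adm' : admissible [:: n, o & w].
    rewrite admissible_cons nV adm andbT /=.
    have [s [t [st ws wt]]] := wset_nontrivial adm.
    by apply: (edge_overlap st); try exact: (sub); apply: (@wset_sub_Iset _ w).
  by exists [:: n, o & w]; rewrite ?wset_cons //= sz.
case: w adm sz => // n [] // o w adm [sz]; have := adm.
rewrite admissible_cons => /and3P[nV _ adm'].
exists n, (wset (o :: w)); split=> //; last by rewrite wset_cons.
  by apply/IH; exists (o :: w) => //; rewrite /= sz.
exact: wset_sub_Dset adm _.
Qed.

Lemma Bfam_sub_Bset k J : Bfam F V k J -> J `<=` Bset F V k.
Proof.
elim: k J => [J [n nV ->]|k IH J [n [E [nV BE sub ->]]]] x.
  by move=> Dx; exists n.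
case=> t Et <-; exists n => //; exists t => //.
by split; [apply: IH BE _ _|apply: sub].
Qed.

(** Each L_n has slope 1/T or -1/T and sends knots of D_n to the subdivision of I_n, so one more
    letter refines the grid by a factor [T]. *)
Lemma wset_grid n w : admissible (n :: w) ->
  let h := H / (T ^ size w)%:R in
  exists2 c, (c < T ^ size w)%N &
    wset (n :: w) = [set` `[kx F n + c%:R * h, kx F n + c.+1%:R * h]].
Proof.
elim: w n => [|o w IH] n adm /=.
  exists 0%N => //; rewrite -/(wset [:: n]) wset1 /Iset mul0r addr0 mul1r divr1.
  by have /= := kx_step (ltn_ord n) => <-; rewrite addrC subrK.
rewrite -/(wset (o :: w)) -/(wset [:: n, o & w]).
have [c cT wE] := IH o (admissible_behead adm).
have := adm; rewrite admissible_cons => /and3P[nV /edgeP[lo_o o_hi] adm'].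
set P := (T ^ size w)%N in cT wE *; set h := H / _ in wE *.
set h' := H / _.
have hl := hi_lo nV.
have T0 : T%:R != 0 :> R by rewrite pnatr_eq0; lia.
have P0 : (0 < P)%N by apply: leq_trans cT.
have Ts0 : P%:R != 0 :> R by rewrite pnatr_eq0 -lt0n.
have Hh : H = P%:R * h by rewrite /h; field.
have hh : h = T%:R * h'.
  by rewrite /h /h' expnS -/P natrM; field; rewrite Ts0 T0.
have lt_lh : kx F (lo F n) < kx F (hi F n) by rewrite kx_lt_nat ?rif_lohi.
have lt_n : kx F n < kx F n.+1 by apply: rif_incr.
(* Comparing end points in L_n(D_n) = I_n yields the slope; the two signs are treated separately. *)
have := Lmap_Dset n; rewrite (wset_cons adm) wE /Lmap /Dset /Iset.
have := slope_neq0 n; move: (slope F n) (icpt F n) => a b a0.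
rewrite !affine_image_itv //.
have stepE : kx F n.+1 = kx F n + H.
  by rewrite -(kx_step (ltn_ord n)) addrC subrK.
have hiE : kx F (hi F n) = kx F (lo F n) + T%:R * H.
  by rewrite (kxE (hiN n)) (kxE (loN n)) hl natrD; ring.
have H0 : H != 0 := lt0r_neq0 mesh_gt0.
case: ifP => a_gt0 /itv_cc_inj[].
- by rewrite lerD2r ler_pM2l // ltW.
- exact: ltW.
- move=> eqlo eqhi; have aT : a * T%:R = 1.
    apply: (mulIf H0); rewrite mul1r -mulrA.
    by move: eqhi; rewrite hiE stepE; lra.
  have ah : a * h = h' by rewrite hh mulrA aT mul1r.
  have [d oE] : exists d, nat_of_ord o = (lo F n + d)%N.
    by exists (o - lo F n)%N; rewrite subnKC.
  have dT : (d < T)%N by move: o_hi; rewrite oE hl ltn_add2l.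
  have xoE : kx F o = kx F (lo F n) + d%:R * (P%:R * h).
    rewrite -Hh (kxE (ltnW (ltn_ord o))) (kxE (loN n)) oE natrD; ring.
  (* I_o is preceded by [d] grid intervals of D_n, each contributing [P] subintervals. *)
  exists (d * P + c)%N.
    apply: (@leq_trans (d.+1 * P)%N); first by rewrite mulSn addnC ltn_add2r.
    by rewrite expnS leq_mul2r dT orbT.
  have lhsE e : a * (kx F o + e * h) + b = kx F n + (d%:R * P%:R + e) * h'.
    by rewrite -eqlo -ah xoE; ring.
  by rewrite !lhsE -natrM -!natrD addnS.
- by rewrite lerD2r ler_nM2l ?ltW // lt_neqAle a0 leNgt a_gt0.
- exact: ltW.
- move=> eqlo eqhi; have aT : a * T%:R = -1.
    apply: (mulIf H0); rewrite mulN1r -mulrA.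
    by move: eqhi eqlo; rewrite hiE stepE; lra.
  have ah : - a * h = h' by rewrite hh mulrA mulNr aT opprK mul1r.
  have [d oE] : exists d, hi F n = (o.+1 + d)%N.
    by exists (hi F n - o.+1)%N; rewrite subnKC.
  have dT : (d < T)%N.
    by rewrite -(ltn_add2l (lo F n)) -hl oE addSn ltnS leq_add2r.
  have xoE : kx F o = kx F (hi F n) - d.+1%:R * (P%:R * h).
    rewrite -Hh (kxE (ltnW (ltn_ord o))) (kxE (hiN n)) oE natrD -!natr1; ring.
  have le_cP : (c.+1 <= d.+1 * P)%N by rewrite (leq_trans cT) // leq_pmull.
  have lhsE e : a * (kx F o + e * h) + b =
      kx F n + (d.+1%:R * P%:R - e) * h' by rewrite -eqlo -ah xoE; ring.
  (* L_n reverses order, so positions are counted from the right end of D_n, and the right end of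
     the old interval, at [c.+1], becomes the left end of the new one. *)
  exists (d.+1 * P - c.+1)%N.
    apply: (@leq_trans (d.+1 * P)%N); first by rewrite ltn_subrL muln_gt0 P0.
    by rewrite expnS leq_mul2r dT orbT.
  by rewrite !lhsE -natrM -subSn // subSS !natrB // ltnW.
Qed.

Lemma admissible_catl w w' : admissible (w ++ w') -> admissible w.
Proof.
by rewrite /admissible all_cat => /andP[/andP[-> _] /cat_sorted2[-> _]].
Qed.

Lemma wset_cell k w : admissible w -> size w = k.+1 ->
  exists i : 'I_(nidx V T k.+1), cell F i = wset w.
Proof.
case: w => // n w adm [sz]; have [/= c] := wset_grid adm; rewrite sz => cT ->.
have nV : n \in V by case/andP: adm => /andP[].
have P0 : (0 < T ^ k)%N by apply: leq_trans cT.
pose e := enum_rank_in nV n.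
(* The rank [e] of the first letter in [V] selects the block, and [c] the position in it. *)
have iP : (e * T ^ k + c < nidx V T k.+1)%N.
  rewrite /nidx /nsub /= (@leq_trans (e.+1 * T ^ k)%N) //.
    by rewrite mulSn addnC ltn_add2r.
  by rewrite leq_mul2r ltn_ord orbT.
exists (Ordinal iP); rewrite /cell; have -> : owner (Ordinal iP) = n.
  rewrite /owner -[RHS](enum_rankK_in nV nV); congr enum_val; apply/val_inj.
  by rewrite /= /nsub divnMDl // divn_small // addn0.
have /= -> : (Ordinal iP %% nsub T k.+1 = c)%N.
  by rewrite /= /nsub modnMDl modn_small.
by rewrite /nsub /mesh invfM !mulrA.
Qed.

Lemma cell_owner k (i : 'I_(nidx V T k)) n w :
  cell F i = wset (n :: w) -> owner i = n.
Proof.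
by move=> ciE; apply/esym/(ownerP _ _ FS); rewrite ciE; apply: wset_sub_Iset.
Qed.

(* Reading a word from its second letter on is what L_{owner i}^-1 does, so the
   edges of the incidence graph of the matrices are the shifts of words. *)
Lemma wset_sub_Dcell k (i j : 'I_(nidx V T k)) n m w :
  admissible (n :: rcons w m) -> cell F i = wset (n :: w) ->
  cell F j = wset (rcons w m) -> cell F j `<=` Dcell F i.
Proof.
move=> adm ciE cjE t; rewrite /Dcell (cell_owner ciE) ciE cjE => wt.
have Dt : Dset F n t.
  by apply: (wset_sub_Dset adm) wt; case: (w).
by split=> //; exists t => //; split=> //; apply: wset_rcons wt.
Qed.

Lemma ThetaP k (i : 'I_(nidx V T k.+1)) : i \in Theta F V T k.+1 <->
  exists2 w, admissible w /\ size w = k.+1 & cell F i = wset w.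
Proof. by rewrite inE; split=> [/asboolP/BfamP//|/BfamP/asboolP]. Qed.

(** * Sliding along words, and irreducibility from positive entries *)

Hypothesis Vconn : strongly_connected F V.

(** Edges point from a letter to its left neighbour, so a path from [o] to [n] has to be reversed;
    [u] is its interior, possibly empty. *)
Lemma admissible_connect n w o w' :
  admissible (rcons w n) -> admissible (o :: w') ->
  exists u, admissible (rcons w n ++ u ++ o :: w').
Proof.
move=> /andP[wV wE] /andP[w'V w'E]; have [_ conn] := Vconn.
have nV : n \in V by move: wV; rewrite all_rcons => /andP[].
have oV : o \in V by case/andP: w'V.
have [p [p0 pV pE pn]] := conn _ _ nV oV.
case: p p0 pV pE pn => // o' p _ pV pE pn.
exists (rev (belast o' p)); apply/andP; split.
  rewrite !all_cat wV w'V andbT all_rev; apply/allP => x /mem_belast xp.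
  by apply: pV; rewrite inE xp orbT.
have pathE : path (fun x y => edge F y x) n (rcons (rev (belast o' p)) o).
  by rewrite -rev_cons -/(belast o (o' :: p)) -{1}pn rev_path.
by rewrite cat_rcons sorted_cat_cons wE -cat_rcons cat_path last_rcons pathE.
Qed.

Section Irreducible.
Variables (k : nat) (A : 'M[R]_(nidx V T k.+1)).
Local Notation X := (Theta F V T k.+1).
Hypothesis A_ge0 : {in X &, forall i j, 0 <= A i j}.
Hypothesis A_gt0 : {in X &, forall i j, cell F j `<=` Dcell F i -> 0 < A i j}.

(** Induction on the letters [s] still to be read: each moves the window of length [k.+1] one place
    to the right, along one positive entry. *)
Lemma word_path s w (i j : 'I_#|X|) : size w = k.+1 -> s != [::] ->
  admissible (w ++ s) -> cell F (enum_val i) = wset w ->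
  cell F (enum_val j) = wset (drop (size s) (w ++ s)) ->
  exists p : seq 'I_#|X|,
    [/\ p != [::], path (fun a b => 0 < submx_on A X a b) i p & last i p = j].
Proof.
elim: s w i => [|m s IH] // [|n w] i // [szw] _ adm ciE cjE.
have {}adm : admissible (n :: (rcons w m ++ s)) by rewrite cat_rcons.
have admm : admissible (n :: rcons w m).
  by move: adm; rewrite -cat_cons; apply: admissible_catl.
have step (j' : 'I_#|X|) : cell F (enum_val j') = wset (rcons w m) ->
    0 < submx_on A X i j'.
  move=> cj'E; rewrite mxE; apply: A_gt0; rewrite ?enum_valP //.
  exact: wset_sub_Dcell admm ciE cj'E.
(* The last letter must lead to the prescribed index [j]; earlier windows get an index from
   [wset_cell]. *)
have [s0|s_neq0] := eqVneq s [::].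
  exists [:: j]; split=> //=; rewrite andbT; apply: step.
  by rewrite cjE s0 /= drop0 cats1.
have szm : size (rcons w m) = k.+1 by rewrite size_rcons szw.
have [j0 cj0] := wset_cell (admissible_behead admm) szm.
have j0X : j0 \in X.
  apply/ThetaP; exists (rcons w m) => //; split=> //.
  exact: admissible_behead admm.
have cj' : cell F (enum_val (enum_rank_in j0X j0)) = wset (rcons w m).
  by rewrite enum_rankK_in.
have [|p [_ pP pj]] := IH _ _ szm s_neq0 (admissible_behead adm) cj'.
  by rewrite cjE /= cat_rcons.
by exists (enum_rank_in j0X j0 :: p); split=> //=; rewrite step.
Qed.

Lemma irreducible_submx : irreducible_mx (submx_on A X).
Proof.
split=> i j; first by rewrite mxE; apply: A_ge0; apply: enum_valP.
have /ThetaP[w [wadm szw] ciE] := enum_valP i.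
have /ThetaP[w' [wadm' szw'] cjE] := enum_valP j.
case: (lastP w) wadm szw ciE => // w0 n wadm szw ciE.
case: w' wadm' szw' cjE => // o w1 wadm' szw' cjE.
have [u adm] := admissible_connect wadm wadm'.
(* The letters to read include the whole target word, so the path is nonempty even if [i = j]; both
   words having length [k.+1], the final window is the target. *)
apply: (word_path szw _ adm ciE); first by case: (u).
have szE : size (u ++ o :: w1) = size (rcons w0 n ++ u).
  by rewrite !size_cat szw szw' addnC.
by rewrite szE catA drop_size_cat.
Qed.

End Irreducible.

(** * Signs of the matrix entries *)

(** S_n attains its minimum on the compact interval, and this positive value bounds the infimum from
    below. *)
Lemma inf_norm_scal_gt0 n a b : a <= b -> [set` `[a, b]] `<=` Dset F n ->
  (forall t, [set` `[a, b]] t -> 0 < scal F n t) ->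
  0 < inf [set `|scal F n t| | t in [set` `[a, b]]].
Proof.
move=> ab sub pos.
have cont := continuous_subspaceW sub (rif_scal_cont FS (n := n)).
have [c cI cmin] := EVT_min ab cont.
apply: (lt_le_trans (pos c cI)); apply: lb_le_inf.
  by exists `|scal F n c|, c.
by move=> _ [t tI <-]; rewrite (le_trans (cmin t tI)) // ler_norm.
Qed.

Lemma inf_le_sup_norm_scal n (E : set R) : E !=set0 -> E `<=` Dset F n ->
  0 <= inf [set `|scal F n t| | t in E] <= sup [set `|scal F n t| | t in E].
Proof.
move=> [t Et] sub; apply/andP; split.
  by apply: lb_le_inf; [exists `|scal F n t|, t|move=> _ [s _ <-]].
apply: (@le_trans _ _ `|scal F n t|).
  by apply: ge_inf; [exists 0 => _ [s _ <-]|exists t].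
apply: ub_le_sup; last by exists t.
by exists 1 => _ [s Es <-]; apply/ltW/(rif_scal_lt1 FS)/sub.
Qed.

(** Cells indexed by [Theta] lie in [Bset F V k.+1], so positivity there suffices; this form serves
    both parts of the theorem. *)
Lemma irreducible_of_scal_gt0 k :
  (forall n, n \in V -> forall t, (Dset F n `&` Bset F V k.+1) t ->
    0 < scal F n t) ->
  irreducible_mx (submx_on (Munder F V T k.+1) (Theta F V T k.+1)) /\
  irreducible_mx (submx_on (Mover F V T k.+1) (Theta F V T k.+1)).
Proof.
move=> pos; pose X := Theta F V T k.+1.
have ne j : j \in X -> cell F j !=set0.
  move=> /ThetaP[[|n w] [adm //] _ ->].
  by have [s [_ [_ ? _]]] := wset_nontrivial adm; exists s.
have bnd (i j : 'I_(nidx V T k.+1)) : j \in X -> cell F j `<=` Dcell F i ->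
    0 <= inf [set `|scal F (owner i) t| | t in cell F j]
      <= sup [set `|scal F (owner i) t| | t in cell F j].
  by move=> jX sub; apply: inf_le_sup_norm_scal (ne j jX) _ => t /sub[].
have inf_gt0 (i j : 'I_(nidx V T k.+1)) : j \in X -> cell F j `<=` Dcell F i ->
    0 < inf [set `|scal F (owner i) t| | t in cell F j].
  move=> jX sub; apply: inf_norm_scal_gt0.
  - have [t] := ne j jX; rewrite /cell /= in_itv /= => /andP[].
    exact: le_trans.
  - by move=> t /sub[].
  - move=> t jt; apply: pos; first exact: enum_valP.
    split; first by have [] := sub t jt.
    apply: (@Bfam_sub_Bset _ (cell F j)) => //.
    by move: jX; rewrite inE => /asboolP.
split; apply: irreducible_submx => i j iX jX.
- by rewrite mxE; case: asboolP => // sub; have /andP[] := bnd i j jX sub.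
- by move=> sub; rewrite mxE asboolT //; apply: inf_gt0.
- rewrite mxE; case: asboolP => // sub.
  by have /andP[i0 is_] := bnd i j jX sub; apply: le_trans is_.
- move=> sub; rewrite mxE asboolT //; apply: (lt_le_trans (inf_gt0 i j jX sub)).
  by have /andP[] := bnd i j jX sub.
Qed.

(** * Compactness of the sets B_k and eventual positivity of S_n *)

Lemma Bset_compact k : compact (Bset F V k).
Proof.
have VE : [set` V] = [set` enum V].
  by apply/seteqP; split=> n /=; rewrite mem_enum.
have cD n : compact (Dset F n) by apply: segment_compact.
elim: k => [|k IH] /=; rewrite VE bigcup_seq; apply: bigsetU_compact => n _ //.
apply: continuous_compact; last first.
  apply: (subclosed_compact _ (cD n)); last exact: subIsetr.
  by apply: closedI; apply: compact_closed => //; apply: Rhausdorff.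
apply: continuous_subspaceT => t.
by apply: cvgD; [apply: cvgM; [exact: cvg_cst|exact: cvg_id]|exact: cvg_cst].
Qed.

(** At the base, a path from [n] to itself starts with an edge to some [m] in [V], so that L_n(D_n)
    = I_n lies in D_m. *)
Lemma Bset_decreasing k : Bset F V k.+1 `<=` Bset F V k.
Proof.
elim: k => [|k IH] t [n nV [s [Bs Ds] <-]].
  have [_ conn] := Vconn.
  have [[|m p] [//= _ pV /andP[nm _] _]] := conn _ _ nV nV.
  exists m; first by apply: pV; rewrite !inE eqxx orbT.
  by move: nm => /asboolP; apply; rewrite -Lmap_Dset; apply: imageP.
by exists n => //; exists s => //; split=> //; apply: IH.
Qed.

Lemma compact_scal_le0 n : compact (Dset F n `&` [set t | scal F n t <= 0]).
Proof.
have cD : compact (Dset F n) by apply: segment_compact.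
apply: (subclosed_compact _ cD).
  (* Continuity of S_n is relative to D_n; since D_n is closed, closedness in the subspace is
     enough. *)
  rewrite closed_setSI; last exact: itv_closed.
  have /continuous_closedP/(_ [set y | y <= 0]) := rif_scal_cont FS (n := n).
  by apply=> y; apply: closed_le.
exact: subIsetl.
Qed.

Lemma scal_gt0_eventually :
  (forall n, n \in V -> forall t, (Dset F n `&` Kset F V) t ->
    0 < scal F n t) ->
  exists k0, forall k, (k0 <= k)%N -> forall n, n \in V ->
    forall t, (Dset F n `&` Bset F V k) t -> 0 < scal F n t.
Proof.
move=> pos.
have /choice[f fP] : forall n, exists k0, n \in V -> forall k, (k0 <= k)%N ->
    Dset F n `&` [set t | scal F n t <= 0] `&` Bset F V k = set0.
  move=> n; have [nV|] := boolP (n \in V); last by exists 0%N.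
  have [||k0 k0P] :=
    nested_compact_disjoint (@compact_scal_le0 n) _ Bset_decreasing.
  - by move=> k; apply: compact_closed; [apply: Rhausdorff|apply: Bset_compact].
  - apply/seteqP; split=> // t [[Dt /= st] Kt].
    by have := pos n nV t (conj Dt Kt); rewrite ltNge st.
  - by exists k0.
(* There are finitely many [n], so one threshold serves them all. *)
exists (\max_n f n)%N => k kM n nV t [Dt Bt]; rewrite ltNge; apply/negP => st.
have fk : (f n <= k)%N by apply: leq_trans kM; apply: leq_bigmax.
suff : set0 t by [].
by rewrite -(fP n nV k fk).
Qed.

End Words.

Theorem theorem2p1 (R : realType) (N : nat) (F : rif_data R N)
    (hF : rif_system F)
    (m : nat) (Lam : 'I_m -> {set 'I_N})
    (Lam_inj : injective Lam)
    (LamP : forall V : {set 'I_N}, scc F V <-> exists r, Lam r = V)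
    (T : 'I_m -> nat)
    (T_ge2 : forall r, (2 <= T r)%N)
    (TP : forall r, ratio_on F (Lam r) (T r))
    (r : 'I_m) :
  ((forall n, n \in Lam r -> forall t, Dset F n t -> 0 < scal F n t) ->
   forall k : nat, (0 < k)%N ->
     irreducible_mx
       (submx_on (Munder F (Lam r) (T r) k) (Theta F (Lam r) (T r) k)) /\
     irreducible_mx
       (submx_on (Mover F (Lam r) (T r) k) (Theta F (Lam r) (T r) k)))
  /\
  ((forall n, n \in Lam r -> forall t, (Dset F n `&` Kset F (Lam r)) t ->
      0 < scal F n t) ->
   exists k0 : nat, (0 < k0)%N /\
   forall k : nat, (k0 <= k)%N ->
     irreducible_mx
       (submx_on (Munder F (Lam r) (T r) k) (Theta F (Lam r) (T r) k)) /\
     irreducible_mx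
       (submx_on (Mover F (Lam r) (T r) k) (Theta F (Lam r) (T r) k))).
Proof.
have [Vconn _] : scc F (Lam r) by apply/LamP; exists r.
have irr := irreducible_of_scal_gt0 hF (T_ge2 r) (TP r) Vconn.
split=> [pos [//|k] _|/(scal_gt0_eventually hF Vconn)[k0 pos]].
  by apply: irr => n nV t [Dt _]; apply: pos nV t Dt.
(* The successor makes the threshold positive and excludes level zero. *)
exists k0.+1; split=> // -[//|k] k0k.
by apply: irr; apply: pos; apply: ltnW.
Qed.
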